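(* Let $(\Omega,\mathcal F,\mathbb P)$ be a complete probability space. Let $C,D$ be two non-empty convexly compact (equivalently: closed, convex and bounded-in-probability) subsets of $\mathbb L^0_+=\mathbb L^0_+(\Omega,\mathcal F,\mathbb P)$, and let $\Phi:C\times D\to\mathbb R$ be a function with the following properties: 1. $f\mapsto\Phi(f,g)$ is concave and upper semi-continuous for all $g\in D$; 2. $g\mapsto\Phi(f,g)$ is convex and lower semi-continuous for all $f\in C$. Then there exists a pair $(f_0,g_0)\in C\times D$ which is a saddle-point of $\Phi$, i.e., $$\Phi(f,g_0)\le\Phi(f_0,g_0)\le\Phi(f_0,g)\quad\text{for all }(f,g)\in C\times D.$$ Moreover, $$\sup_{f\in C}\inf_{g\in D}\Phi(f,g)=\inf_{g\in D}\sup_{f\in C}\Phi(f,g).$$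
   Context: $\mathbb L^0$ denotes the real vector space of $\mathbb P$-a.s. equivalence classes of real-valued random variables on $(\Omega,\mathcal F,\mathbb P)$, equipped with the topology of convergence in probability, induced by the metric $d(f,g)=\mathbb E[1\wedge|f-g|]$; $\mathbb L^0_+=\{f\in\mathbb L^0: f\ge 0 \text{ a.s.}\}$. Closedness and semi-continuity refer to this topology. A set $A\subseteq\mathbb L^0$ is bounded in probability if $\lim_{M\to\infty}\sup_{f\in A}\mathbb P[|f|\ge M]=0$. The sets $C$ and $D$ are assumed closed, convex and bounded in probability, which for closed convex subsets of $\mathbb L^0_+$ is the same as being convexly compact, where: a convex subset $C$ of a topological vector space is convexly compact if for any non-empty index set $A$ and any family $\{F_\alpha\}_{\alpha\in A}$ of closed and convex subsets of $C$, the condition that $\bigcap_{\alpha\in E}F_\alpha\ne\emptyset$ for every non-empty finite $E\subseteq A$ implies $\bigcap_{\alpha\in A}F_\alpha\neq\emptyset$. Suprema and infima are taken in $[-\infty,\infty]$. *)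

(* Defs.v *)
From HB Require Import structures.
From mathcomp Require Import all_boot all_order all_algebra.
From mathcomp Require Import all_classical all_reals all_analysis.
From mathcomp Require Import measurable_realfun lra.

Set Implicit Arguments.
Unset Strict Implicit.
Unset Printing Implicit Defensive.

Import Order.TTheory GRing.Theory Num.Theory.
Import numFieldNormedType.Exports.

Local Open Scope classical_set_scope.
Local Open Scope ring_scope.
Local Open Scope quotient_scope.

Section L0.
Context (d : measure_display) (T : measurableType d) (R : realType).
Variable P : probability T R.

Definition L0 : Type := {mfun_ P, T >-> R}.
HB.instance Definition _ := Choice.on L0.

(* An element of L0 coerces to an (arbitrary) representative of its class;
   statements about it are meant up to P-null sets. *)
Definition L0_fun (f : L0) : {mfun T >-> R} := repr (f : {mfun_ P, T >-> R}).
Coercion L0_fun : L0 >-> MeasurableFun.type.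

Definition L0_class (f : {mfun T >-> R}) : L0 := \pi_({mfun_ P, T >-> R}) f.

Lemma L0_funK (f : L0) : L0_class f = f.
Proof. exact: reprK. Qed.

Lemma L0_classP (f g : {mfun T >-> R}) :
  L0_class f = L0_class g <-> f = g %[ae P].
Proof.
by split => [/eqmodP/asboolP //|fg]; apply/eqmodP/asboolP; exact: fg.
Qed.

Lemma L0_classK (f : {mfun T >-> R}) : L0_class f = f %[ae P].
Proof. by apply/L0_classP; rewrite L0_funK. Qed.

Lemma L0P (f g : L0) : f = g <-> f = g %[ae P].
Proof. by rewrite -L0_classP !L0_funK. Qed.

Let zero : L0 := L0_class 0.
Let opp (f : L0) : L0 := L0_class (- (f : {mfun T >-> R})).
Let add (f g : L0) : L0 :=
  L0_class ((f : {mfun T >-> R}) + (g : {mfun T >-> R})).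
Let scale (a : R) (f : L0) : L0 := L0_class (a *: (f : {mfun T >-> R})).

Let zeroE : zero = cst 0 %[ae P].
Proof. exact: L0_classK. Qed.

Let oppE (f : L0) : opp f = \- f %[ae P].
Proof. exact: L0_classK. Qed.

Let addE (f g : L0) : add f g = f \+ g %[ae P].
Proof. exact: L0_classK. Qed.

Let scaleE (a : R) (f : L0) : scale a f = (fun x => a * f x) %[ae P].
Proof. exact: L0_classK. Qed.

Let addA : associative add.
Proof.
move=> f g h; apply/L0P.
apply: filterS2 (filterI (addE (add f g) h) (addE f g))
  (filterI (addE f (add g h)) (addE g h)).
move=> x [/(_ I) e1 /(_ I) e2] [/(_ I) e3 /(_ I) e4] _.
by rewrite e3 /= e4 /= e1 /= e2 /= addrA.
Qed.

Let addC : commutative add.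
Proof.
move=> f g; apply/L0P; have := addE f g; have := addE g f.
by apply: filterS2 => x /(_ I) e1 /(_ I) e2 _; rewrite e1 e2 /= addrC.
Qed.

Let add0 : left_id zero add.
Proof.
move=> f; apply/L0P; have := addE zero f; have := zeroE.
by apply: filterS2 => x /(_ I) e1 /(_ I) e2 _; rewrite e2 /= e1 /= add0r.
Qed.

Let addN : left_inverse zero opp add.
Proof.
move=> f; apply/L0P; have := addE (opp f) f; have := oppE f; have := zeroE.
apply: filterS3 => x /(_ I) e1 /(_ I) e2 /(_ I) e3 _.
by rewrite e3 /= e2 /= e1 /= addNr.
Qed.

HB.instance Definition _ := GRing.isZmodule.Build L0 addA addC add0 addN.

Let scaleA (a b : R) (f : L0) : scale a (scale b f) = scale (a * b) f.
Proof.
apply/L0P; have := scaleE a (scale b f); have := scaleE b f.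
have := scaleE (a * b) f.
apply: filterS3 => x /(_ I) e1 /(_ I) e2 /(_ I) e3 _.
by rewrite e3 e2 e1 mulrA.
Qed.

Let scale1 : left_id 1 scale.
Proof.
move=> f; apply/L0P; have := scaleE 1 f.
by apply: filterS => x /(_ I) e1 _; rewrite e1 mul1r.
Qed.

Let scaleDr : right_distributive scale +%R.
Proof.
move=> a f g; apply/L0P.
apply: filterS3 (filterI (scaleE a f) (scaleE a g))
  (addE (scale a f) (scale a g)) (filterI (scaleE a (add f g)) (addE f g)).
move=> x [/(_ I) e1 /(_ I) e2] /(_ I) e3 [/(_ I) e4 /(_ I) e5] _.
by rewrite e4 e5 /= e3 /= e1 e2 mulrDr.
Qed.

Let scaleDl (f : L0) : {morph scale^~ f : a b / a + b}.
Proof.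
move=> a b; apply/L0P.
apply: filterS3 (filterI (scaleE a f) (scaleE b f))
  (addE (scale a f) (scale b f)) (scaleE (a + b) f).
move=> x [/(_ I) e1 /(_ I) e2] /(_ I) e3 /(_ I) e4 _.
by rewrite e4 e3 /= e2 e1 mulrDl.
Qed.

HB.instance Definition _ :=
  GRing.Zmodule_isLmodule.Build R L0 scaleA scale1 scaleDr scaleDl.

Lemma L0_0E : (0 : L0) = cst 0 %[ae P].
Proof. exact: zeroE. Qed.

Lemma L0_NE (f : L0) : (- f : L0) = \- f %[ae P].
Proof. exact: oppE. Qed.

Lemma L0_DE (f g : L0) : (f + g : L0) = f \+ g %[ae P].
Proof. exact: addE. Qed.

Lemma L0_ZE (a : R) (f : L0) : (a *: f : L0) = (fun x => a * f x) %[ae P].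
Proof. exact: scaleE. Qed.

(* The expectation is finite, being at most 1, so that [fine] loses nothing. *)
Definition L0_dist (f g : L0) : R :=
  fine 'E_P[fun x => Num.min 1 `|f x - g x|].

Let mf_dist (f g : L0) :
  measurable_fun setT (fun x => (Num.min 1 `|f x - g x|)%:E).
Proof.
apply/measurable_EFinP; apply: measurable_minr => //.
apply: measurableT_comp => //; exact: measurable_funB.
Qed.

Let dist_ge0 (f g : L0) x : (0 <= (Num.min 1 `|f x - g x|)%:E)%E.
Proof. by rewrite lee_fin le_min ler01 normr_ge0. Qed.

Let L0_distE (f g : L0) :
  (L0_dist f g)%:E = (\int[P]_x (Num.min 1 `|f x - g x|)%:E)%E.
Proof.
rewrite /L0_dist unlock fineK// ge0_fin_numE ?integral_ge0//.
apply: (@le_lt_trans _ _ (\int[P]_x (cst 1 x))%E); last first.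
  by rewrite integral_cst// [X in (_ * X)%E]probability_setT mule1 ltry.
by apply: ge0_le_integral => // x _; rewrite lee_fin ge_min lexx.
Qed.

Let distxx (f : L0) : L0_dist f f = 0.
Proof.
apply: EFin_inj; rewrite L0_distE; apply: integral0_eq => x _.
by rewrite subrr normr0 min_r.
Qed.

Let dist_eq0 (f g : L0) : L0_dist f g = 0 -> f = g.
Proof.
move=> fg0; apply/L0P.
have : (\int[P]_x `|(Num.min 1 `|f x - g x|)%:E|)%E = 0.
  by under eq_integral do rewrite gee0_abs//; rewrite -L0_distE fg0.
move/(ae_eq_integral_abs P measurableT (mf_dist f g)).
apply: filterS => x /(_ I) [] e0 _; apply/eqP; rewrite -subr_eq0 -normr_eq0.
move: e0; rewrite minEle; case: ifP => _ /= /eqP //.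
by rewrite (oner_eq0 R).
Qed.

Let dist_sym (f g : L0) : L0_dist f g = L0_dist g f.
Proof.
by apply: EFin_inj; rewrite !L0_distE; apply: eq_integral => x _; rewrite distrC.
Qed.

Let min1_dist_triangle (a b c : R) :
  Num.min 1 `|a - c| <= Num.min 1 `|a - b| + Num.min 1 `|b - c|.
Proof.
have abc := ler_distD b a c.
have ab0 := normr_ge0 (a - b); have bc0 := normr_ge0 (b - c).
rewrite !minEle; case: (leP 1 `|a - c|) => ?;
  case: (leP 1 `|a - b|) => ?; case: (leP 1 `|b - c|) => ?; lra.
Qed.

Let dist_triangle (g f h : L0) : L0_dist f h <= L0_dist f g + L0_dist g h.
Proof.
rewrite -lee_fin EFinD !L0_distE -ge0_integralD//.
apply: ge0_le_integral => //.
- exact: emeasurable_funD.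
move=> x _; rewrite -EFinD lee_fin.
exact: (min1_dist_triangle (f x) (g x) (h x)).
Qed.

HB.instance Definition _ :=
  @isMetric.Build R L0 L0_dist distxx dist_eq0 dist_sym dist_triangle.

Let eq_dist (f g f' g' : L0) :
    (\forall x \ae P, `|f x - g x| = `|f' x - g' x|) ->
  L0_dist f g = L0_dist f' g'.
Proof.
move=> e; apply: EFin_inj; rewrite !L0_distE.
apply: ae_eq_integral => //; apply: filterS e => x e _.
by rewrite e.
Qed.

Let distD2r (f g h : L0) : L0_dist (f + h) (g + h) = L0_dist f g.
Proof.
apply: eq_dist; apply: filterS2 (L0_DE f h) (L0_DE g h).
by move=> x /(_ I) -> /(_ I) ->; rewrite /= opprD addrACA subrr addr0.
Qed.

Let distD2l (f g h : L0) : L0_dist (h + f) (h + g) = L0_dist f g.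
Proof. by rewrite !(addrC h) distD2r. Qed.

Let mf_min1 (a : R) (h : {mfun T >-> R}) :
  measurable_fun setT (fun x => (Num.min 1 (`|a| * `|h x|))%:E).
Proof.
apply/measurable_EFinP; apply: measurable_minr => //.
by apply: measurable_funM => //; exact: measurableT_comp.
Qed.

Let min1_ge0 (a : R) (h : {mfun T >-> R}) x :
  (0 <= (Num.min 1 (`|a| * `|h x|))%:E)%E.
Proof. by rewrite lee_fin le_min ler01 mulr_ge0. Qed.

Let dist_scaleE (f g : L0) (a : R) : (L0_dist (a *: f) (a *: g))%:E =
  (\int[P]_x (Num.min 1 (`|a| * `|((f : {mfun T >-> R}) - (g : {mfun T >-> R})) x|))%:E)%E.
Proof.
rewrite L0_distE; apply: ae_eq_integral => //.
apply: filterS2 (L0_ZE a f) (L0_ZE a g) => x /(_ I) -> /(_ I) -> _.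
by rewrite -mulrBr normrM.
Qed.

Let dist_scaleBE (f : L0) (a b : R) : (L0_dist (a *: f) (b *: f))%:E =
  (\int[P]_x (Num.min 1 (`|a - b| * `|f x|))%:E)%E.
Proof.
rewrite L0_distE; apply: ae_eq_integral => //.
apply: filterS2 (L0_ZE a f) (L0_ZE b f) => x /(_ I) -> /(_ I) -> _.
by rewrite -mulrBl normrM.
Qed.

Let dist_scale (f g : L0) (a : R) (n : nat) : `|a| <= n.+1%:R ->
  L0_dist (a *: f) (a *: g) <= n.+1%:R * L0_dist f g.
Proof.
move=> an; rewrite -lee_fin EFinM dist_scaleE L0_distE -ge0_integralZl//.
apply: ge0_le_integral => //; first exact: measurable_funeM.
move=> x _; rewrite -EFinM lee_fin mfunB /=.
set t := `|f x - g x|; have t0 : 0 <= t := normr_ge0 _.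
have n1 : 1 <= n.+1%:R :> R by rewrite ler1n.
by rewrite !minEle; case: (leP 1 t) => ?; case: (leP 1 (`|a| * t)) => ?; nra.
Qed.

Let scale_small (f : L0) (e : R) : 0 < e -> exists n : nat,
  (\int[P]_x (Num.min 1 (`|n.+1%:R^-1| * `|f x|))%:E < e%:E)%E.
Proof.
move=> e0.
have [|||||_ _ cvg0] := @dominated_convergence _ T R P setT measurableT
  (fun n x => (Num.min 1 (`|n.+1%:R^-1| * `|f x|))%:E) (cst 0%E) (cst 1%E).
- by move=> n; exact: mf_min1.
- exact: measurable_cst.
- apply: aeW => x _; apply: cvg_EFin; first exact: nearW.
  apply: (@squeeze_cvgr _ _ _ _ (cst 0) (fun n => n.+1%:R^-1 * `|f x|)).
  + apply: nearW => n /=; rewrite ger0_norm// le_min ler01 mulr_ge0//=.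
    by rewrite ge_min lexx orbT.
  + exact: cvg_cst.
  + rewrite -[X in _ --> X](mul0r `|f x|); apply: cvgM.
      exact: cvg_harmonic.
    exact: cvg_cst.
- exact: finite_measure_integrable_cst.
- apply: aeW => x n _; rewrite gee0_abs//.
  by rewrite lee_fin ge_min lexx.
rewrite integral0 in cvg0.
have [n _ /(_ n (leqnn n))] : \forall n \near \oo,
    (\int[P]_x (Num.min 1 (`|n.+1%:R^-1| * `|f x|))%:E < e%:E)%E.
  apply: (cvg0 [set y | y < e%:E]%E); apply: open_nbhs_nbhs; split.
    exact: open_ereal_lt_ereal.
  by rewrite /= lte_fin.
by exists n.
Qed.

Let add_continuous : continuous (fun x : L0 * L0 => x.1 + x.2).
Proof.
move=> [f g]; apply/cvg_ballP => e e0; near=> z.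
rewrite ballEmdist /=.
rewrite (le_lt_trans (dist_triangle (z.1 + g) (f + g) (z.1 + z.2)))//.
rewrite distD2r distD2l (splitr e) ltrD//; near: z.
- exists (ball f (e / 2), setT) => /=.
    by split; [apply: nbhsx_ballx; rewrite divr_gt0|exact: filterT].
  by move=> z [/=]; rewrite ballEmdist.
- exists (setT, ball g (e / 2)) => /=.
    by split; [exact: filterT|apply: nbhsx_ballx; rewrite divr_gt0].
  by move=> z [/= _]; rewrite ballEmdist.
Unshelve. all: by end_near. Qed.

Let scale_continuous : continuous (fun z : R^o * L0 => z.1 *: z.2).
Proof.
move=> [a f]; apply/cvg_ballP => e e0; rewrite /=.
have e20 : 0 < e / 2 by rewrite divr_gt0.
have [n fn] := scale_small f e20.
pose m := Num.trunc (`|a| + 1).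
have am : `|a| + 1 < m.+1%:R by apply: truncnS_gt.
near=> z.
have zan : `|a - z.1| <= n.+1%:R^-1.
  near: z.
  exists (ball a n.+1%:R^-1, setT) => /=.
    by split; [apply: nbhsx_ballx; rewrite invr_gt0|exact: filterT].
  by move=> z [/= + _] => /ltW.
have za1 : `|z.1| <= m.+1%:R.
  rewrite (le_trans _ (ltW am))// -(subrK a z.1) (le_trans (ler_normD _ _))//.
  by rewrite addrC lerD2l distrC (le_trans zan)// invf_le1// ler1n.
rewrite ballEmdist /=.
rewrite (le_lt_trans (dist_triangle (z.1 *: f) (a *: f) (z.1 *: z.2)))//.
rewrite (splitr e) ltrD//.
  rewrite -lte_fin dist_scaleBE (le_lt_trans _ fn)//.
  apply: ge0_le_integral => // x _; rewrite lee_fin.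
  have h : `|a - z.1| * `|(f : L0) x| <= `|n.+1%:R^-1| * `|(f : L0) x|.
    by rewrite ler_wpM2r// [leRHS]ger0_norm.
  by rewrite le_min !ge_min lexx h orbT.
rewrite (le_lt_trans (dist_scale f z.2 za1))// mulrC -ltr_pdivlMr//; near: z.
exists (setT, ball f (e / 2 / m.+1%:R)) => /=.
  by split; [exact: filterT|apply: nbhsx_ballx; rewrite !divr_gt0].
by move=> z [/= _]; rewrite ballEmdist.
Unshelve. all: by end_near. Qed.

HB.instance Definition _ :=
  PreTopologicalNmodule_isTopologicalNmodule.Build L0 add_continuous.
HB.instance Definition _ :=
  TopologicalNmodule_isTopologicalLmodule.Build R L0 scale_continuous.

End L0.

Section convexity_semicontinuity.
Context (R : realType).

Definition concave_function (E : lmodType R) (D : set (convex_lmodType E))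
    (f : convex_lmodType E -> R^o) :=
  convex_function D (\- f).

Definition upper_semicontinuous (X : topologicalType) (f : X -> \bar R) :=
  lower_semicontinuous (fun x => - f x)%E.

(* [finI] also asks for the empty intersection, that is the whole space, to be
   non-empty, which holds in any vector space. *)
Definition convexly_compact (V : topologicalLmodType R) (C : set V) :=
  convex_set C /\
  forall (I : choiceType) (A : set I) (F : I -> set V), A !=set0 ->
    (forall i, A i -> [/\ closed (F i), convex_set (F i) & F i `<=` C]) ->
    finI A F -> \bigcap_(i in A) F i !=set0.

End convexity_semicontinuity.

Section L0_sets.
Context (d : measure_display) (T : measurableType d) (R : realType).
Variable P : probability T R.

Definition L0_plus : set (L0 P) := [set f | \forall x \ae P, 0 <= f x].

(* For empty [A] the supremum is -oo; the notion is meant for non-empty sets. *)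
Definition bounded_in_probability (A : set (L0 P)) :=
  ereal_sup [set P [set x | M <= `|f x|] | f in A] @[M --> +oo] --> 0%E.

End L0_sets.

Arguments L0_plus {d T R} P.

(* Main.v *)
(* A bounded-in-probability convex set C of nonnegative functions is convexly
   compact because J(f) = E[1/(1+f)] is uniformly convex on it: if V is the
   supremum over finite subfamilies K of inf J on the intersection of the F_i
   with i in K, then the sets of almost minimizers {J <= V + r} of these
   intersections generate a Cauchy filter, whose limit in the complete space L0
   lies in every closed F_i.

   For the minimax part, suppose that a < sup_f Phi(f, g) for every g. By
   induction, finitely many sets {f | a < Phi(f, g_i)} have a common point: if
   {a < Phi(., g)} and {a < Phi(., g')} were disjoint, some convex combination
   t Phi(., g) + (1 - t) Phi(., g') would be at most a, hence so would be
   Phi(., t g + (1 - t) g'). Convex compactness then gives f0 with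
   inf_sup <= Phi(f0, g) for all g. The same argument applied to -Phi gives g0
   with Phi(f, g0) <= sup_inf for all f, and (f0, g0) is a saddle point. *)

Require Import Defs.
From HB Require Import structures.
From mathcomp Require Import all_boot all_order all_algebra.
From mathcomp Require Import all_classical all_reals all_analysis.
From mathcomp Require Import measurable_realfun finmap ring lra.

Set Implicit Arguments.
Unset Strict Implicit.
Unset Printing Implicit Defensive.

Import Order.TTheory GRing.Theory Num.Theory.
Import numFieldNormedType.Exports.

Local Open Scope classical_set_scope.
Local Open Scope ring_scope.

(** * Concave alternatives and a one-sided minimax bound on convexly compact sets *)

Section concave_convex.
Context (R : realType).
Local Open Scope convex_scope.

Lemma concave_functionP (E : lmodType R) (X : set (convex_lmodType E))
    (f : convex_lmodType E -> R^o) : concave_function X f <->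
  forall (t : {i01 R}) x y, X x -> X y ->
    t%:num * f x + (1 - t%:num) * f y <= f (x <| t |> y).
Proof.
split=> [cf t x y Xx Xy|cf t x y /set_mem Xx /set_mem Xy].
  have := cf t x y (mem_set Xx) (mem_set Xy).
  by rewrite convRE /= !mulrN -opprD lerN2.
by rewrite convRE /= !mulrN -opprD lerN2; exact: cf.
Qed.

Lemma convex_set_gt (E : lmodType R) (X : set (convex_lmodType E))
    (f : convex_lmodType E -> R^o) (a : R) :
  convex_set X -> concave_function X f ->
  convex_set (X `&` [set x | a < f x]).
Proof.
move=> cX /concave_functionP cf; apply/convex_setW.
move=> x y /set_mem[Xx ax] /set_mem[Xy ay] t t0 t1.
apply/mem_set; split; first by apply/set_mem/cX; exact/mem_set.
rewrite /= in ax ay *; apply: lt_le_trans (cf t x y Xx Xy).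
by nra.
Qed.

Lemma convex_set_ge (E : lmodType R) (X : set (convex_lmodType E))
    (f : convex_lmodType E -> R^o) (a : R) :
  convex_set X -> concave_function X f ->
  convex_set (X `&` [set x | a <= f x]).
Proof.
move=> cX /concave_functionP cf; apply/convex_setW.
move=> x y /set_mem[Xx ax] /set_mem[Xy ay] t t0 t1.
apply/mem_set; split; first by apply/set_mem/cX; exact/mem_set.
rewrite /= in ax ay *; apply: le_trans (cf t x y Xx Xy).
by nra.
Qed.

(** The condition on t is linear at each point: where [f2 y > a] it bounds t below by (f2 y - a) /
    (f2 y - f1 y), and where [f1 x > a] it bounds t above by (a - f2 x) / (f1 x - f2 x). By [cross]
    every lower bound is at most every upper bound, so the supremum of the lower bounds works. *)
Lemma concave_alternative (E : lmodType R) (X : set (convex_lmodType E))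
    (f1 f2 : convex_lmodType E -> R^o) (a : R) :
  convex_set X -> concave_function X f1 -> concave_function X f2 ->
  (forall x, X x -> ~ (a < f1 x /\ a < f2 x)) ->
  exists t : {i01 R}, forall x, X x ->
    t%:num * f1 x + (1 - t%:num) * f2 x <= a.
Proof.
move=> cX /concave_functionP cf1 /concave_functionP cf2 noX.
have cross x y : X x -> X y -> a < f1 x -> a < f2 y ->
    [/\ f2 x <= a, f1 y <= a &
    (f2 y - a) * (f1 x - a) <= (f1 y - a) * (f2 x - a)].
  move=> Xx Xy f1x f2y.
  have f2x : f2 x <= a by rewrite leNgt; apply/negP => ?; exact: (noX x).
  have f1y : f1 y <= a by rewrite leNgt; apply/negP => ?; exact: (noX y).
  split => //; rewrite leNgt; apply/negP => h.
  (* The weights u / (u + v) and v / (u + v) make the two interpolated values, of [f1] and of [f2],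
     coincide. Their common excess over [a] is, up to the factor u + v, the difference of the two
     products in [h], so both exceed [a] at a point of [X]. *)
  set u : R := f2 y - f1 y; set v : R := f1 x - f2 x.
  have u0 : 0 < u by rewrite subr_gt0; exact: le_lt_trans f2y.
  have v0 : 0 < v by rewrite subr_gt0; exact: le_lt_trans f1x.
  have uv0 : 0 < u + v by rewrite addr_gt0.
  have t0 : 0 <= u / (u + v) by rewrite divr_ge0// ltW.
  have t1 : u / (u + v) <= 1 by rewrite ler_pdivrMr// mul1r lerDl ltW.
  have tE : 1 - u / (u + v) = v / (u + v).
    by rewrite -[1](divff (lt0r_neq0 uv0)) -mulrBl addrAC subrr add0r.
  set t : {i01 R} := Itv01 t0 t1.
  have tnum : t%:num = u / (u + v) by [].
  have Xt : X (x <| t |> y) by apply/set_mem/cX; exact/mem_set.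
  have gain k l (p q : R) : p - a = k -> q - a = l -> 0 < u * k + v * l ->
      a < t%:num * p + (1 - t%:num) * q.
    move=> kE lE kl; rewrite tnum tE mulrAC [v / _ * _]mulrAC -mulrDl.
    by rewrite ltr_pdivlMr//; move: kl; rewrite -kE -lE; lra.
  apply: (noX _ Xt); split.
    apply: lt_le_trans (cf1 t x y Xx Xy); apply: gain erefl erefl _.
    by rewrite /u /v; lra.
  apply: lt_le_trans (cf2 t x y Xx Xy); apply: gain erefl erefl _.
  by rewrite /u /v; lra.
(* Adjoining 0 keeps [S] non-empty and its supremum non-negative even if [f2] never exceeds [a]. *)
pose S : set R := [set r | r = 0 \/
  exists y, [/\ X y, a < f2 y & r = (f2 y - a) / (f2 y - f1 y)]].
have le1 y : X y -> a < f2 y ->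
    0 < f2 y - f1 y /\ (f2 y - a) / (f2 y - f1 y) <= 1.
  move=> Xy f2y.
  have f1y : f1 y <= a by rewrite leNgt; apply/negP => ?; exact: (noX y).
  have d0 : 0 < f2 y - f1 y by rewrite subr_gt0; exact: le_lt_trans f2y.
  by split => //; rewrite ler_pdivrMr// mul1r lerD2l lerN2.
have S0 : S !=set0 by exists 0; left.
have S1 : ubound S 1.
  by move=> _ [->|[y [Xy f2y ->]]]; [exact: ler01|case: (le1 y Xy f2y)].
have t0 : 0 <= sup S by apply: ub_le_sup; [exists 1|left].
have t1 : sup S <= 1 by exact: ge_sup.
exists (Itv01 t0 t1) => x Xx; rewrite [_%:num]/=.
have [f1x|f1x] := ltP a (f1 x).
  have f2x : f2 x <= a by rewrite leNgt; apply/negP => ?; exact: (noX x).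
  have d0 : 0 < f1 x - f2 x by rewrite subr_gt0; exact: le_lt_trans f1x.
  have : sup S <= (a - f2 x) / (f1 x - f2 x).
    apply: ge_sup => // _ [->|[y [Xy f2y ->]]].
      by rewrite divr_ge0 ?subr_ge0// -subr_ge0 ltW.
    have [_ f1y xy] := cross x y Xx Xy f1x f2y.
    have [d1 _] := le1 y Xy f2y.
    rewrite ler_pdivrMr// mulrAC ler_pdivlMr//.
    by nra.
  rewrite ler_pdivlMr//; nra.
have [f2x|f2x] := ltP a (f2 x); last by nra.
have [d1 _] := le1 x Xx f2x.
have : (f2 x - a) / (f2 x - f1 x) <= sup S.
  by apply: ub_le_sup; [exists 1|right; exists x].
by rewrite ler_pdivrMr//; nra.
Qed.

Lemma exists_gt_seq (E G : lmodType R) (X : set (convex_lmodType E))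
    (D : set (convex_lmodType G)) (Phi : E -> G -> R) (a : R) (s : seq G) :
  convex_set X -> X !=set0 -> convex_set D ->
  (forall g, D g -> concave_function X (fun f => Phi f g)) ->
  (forall f, X f -> convex_function D (fun g => Phi f g)) ->
  (forall g, D g -> exists2 f, X f & a < Phi f g) ->
  (forall g, g \in s -> D g) ->
  exists2 f, X f & forall g, g \in s -> a < Phi f g.
Proof.
move=> + + cD; elim: s X => [|g s IH] X cX [x0 Xx0] ccv cvx Xa sD.
  by exists x0.
have Dg : D g by apply: sD; rewrite inE eqxx.
pose X' : set (convex_lmodType E) := X `&` [set f | a < Phi f g].
have X'X : X' `<=` X by move=> ? [].
(* The induction varies the set: the remaining points of [s] are treated on [X']. What must be
   rechecked is that each Phi(., g') still exceeds [a] somewhere on [X']; this is where the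
   alternative is applied to g and g'. *)
have [||||g' Dg'|g' g's|f [Xf fg] fs] := IH X'.
- exact: convex_set_gt (ccv g Dg).
- by have [f Xf fg] := Xa g Dg; exists f.
- move=> g' Dg' t x y /set_mem/X'X Xx /set_mem/X'X Xy.
  exact: (ccv g' Dg' t x y (mem_set Xx) (mem_set Xy)).
- by move=> f /X'X; exact: cvx.
- apply: contrapT => noX'.
  have [x Xx [f1 f2]|t tX] :=
      concave_alternative (a := a) cX (ccv g Dg) (ccv g' Dg').
    by apply: noX'; exists x.
  have Dt : D ((g : convex_lmodType G) <| t |> g').
    by apply/set_mem/cD; exact/mem_set.
  have [f Xf] := Xa _ Dt; apply/negP; rewrite -leNgt.
  apply: le_trans (tX _ Xf).
  exact: (cvx f Xf t g g' (mem_set Dg) (mem_set Dg')).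
- by apply: sD; rewrite inE g's orbT.
exists f => // g'; rewrite inE => /predU1P[->//|]; exact: fs.
Qed.

(** Semicontinuity is relative to [C]; closedness of [C] carries relatively closed superlevel sets
    over to the ambient space. *)
Lemma closed_ge_subspace (X : topologicalType) (C : set X) (f : X -> R)
    (a : R) : closed C ->
  upper_semicontinuous (fun x : subspace C => (f x)%:E) ->
  closed (C `&` [set x | a <= f x]).
Proof.
move=> clC /lower_semicontinuousP /(_ (- a)) uf.
rewrite closed_setSI//.
rewrite (_ : [set x | _] = ~` [set x | ((- a)%:E < - (f x)%:E)%E]).
  exact: open_closedC.
by apply/seteqP; split => x /=; rewrite lte_fin ltrN2 leNgt => /negP.
Qed.

(** The levels form a set [A] so that an infinite minimax value is covered too: [A] will consist of
    all real levels below it. The superlevel sets are indexed by pairs of a level and a point of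
    [D]. *)
Lemma convexly_compact_minimax (V : topologicalLmodType R) (G : lmodType R)
    (C : set V) (D : set (convex_lmodType G)) (Phi : V -> G -> R) (A : set R) :
  convexly_compact C -> closed C -> C !=set0 -> convex_set D ->
  (forall g, D g -> concave_function C (fun f => Phi f g)) ->
  (forall g, D g ->
     upper_semicontinuous (fun f : subspace C => (Phi f g)%:E)) ->
  (forall f, C f -> convex_function D (fun g => Phi f g)) ->
  (forall a g, A a -> D g -> exists2 f, C f & a < Phi f g) ->
  exists2 f, C f & forall a g, A a -> D g -> a <= Phi f g.
Proof.
move=> [cC kC] clC C0 cD ccv usc cvx AD.
(* Convex compactness asks for a non-empty index set; without any pair the bound is vacuous and
   every point of [C] serves. *)
have [AD0|] := pselect (A `*` D !=set0); last first.
  move=> AD0; case: C0 => f Cf; exists f => // a g Aa Dg.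
  by exfalso; apply: AD0; exists (a, g).
pose F (i : R * G) := C `&` [set f | i.1 <= Phi f i.2].
have [|K KAD|f fF] := kC _ (A `*` D) F AD0.
- move=> [a g] [/= Aa Dg]; split; last by move=> ? [].
  + exact: closed_ge_subspace (usc g Dg).
  + exact: convex_set_ge (ccv g Dg).
- have [->|[i0 i0K]] := fset_0Vmem K.
    by case: C0 => f Cf; exists f => i; rewrite /= inE.
  (* A point that beats the largest level in [K] at every listed g lies in all the sets indexed by
     [K]. *)
  have [i _ imax] := @Order.TotalTheory.arg_maxP _ _ K [` i0K]%fset xpredT
    (fun i => (val i).1) isT.
  have /set_mem[Aa _] : val i \in A `*` D by apply/KAD/valP.
  have [g|f Cf fs] := @exists_gt_seq V G C D Phi (val i).1
      [seq j.2 | j <- enum_fset K] cC C0 cD ccv cvx (fun g => AD _ g Aa).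
    by move=> /mapP[j jK ->]; have /set_mem[] := KAD j jK.
  exists f => j /= jK; split => //=.
  have jK' : j.2 \in [seq j.2 | j <- enum_fset K] by apply/mapP; exists j.
  apply: ltW; apply: le_lt_trans (fs _ jK').
  exact: (imax [` jK]%fset).
exists f => [|a g Aa Dg]; last by have /(_ (conj Aa Dg))[] := fF (a, g).
by case: AD0 => i ADi; have [] := fF i ADi.
Qed.

End concave_convex.

(** * Limits of fast Cauchy sequences for convergence in probability *)

Section L0_complete.
Context (d : measure_display) (T : measurableType d) (R : realType).
Variable P : probability T R.
Implicit Types f g h : L0 P.

Lemma integrable_01 (u : T -> R) : measurable_fun setT u ->
  (forall x, 0 <= u x <= 1) -> P.-integrable setT (EFin \o u).
Proof.
move=> mu u01; have := finite_measure_integrable_cst P 1 measurableT.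
apply: le_integrable => //; first exact/measurable_EFinP.
move=> x _ /=; rewrite lee_fin normr1.
by have /andP[u0 u1] := u01 x; rewrite ger0_norm.
Qed.

Lemma min1_01 (x y : R) : 0 <= Num.min 1 `|x - y| <= 1.
Proof. by rewrite le_min ler01 normr_ge0 ge_min lexx. Qed.

Lemma measurable_min1 f g :
  measurable_fun setT (fun x => Num.min 1 `|f x - g x|).
Proof.
apply: measurable_minr => //; apply: measurableT_comp => //.
exact: measurable_funB.
Qed.

Lemma integrable_min1 f g :
  P.-integrable setT (EFin \o fun x => Num.min 1 `|f x - g x|).
Proof.
by apply: integrable_01 => [|x]; [exact: measurable_min1|exact: min1_01].
Qed.

Lemma L0_dist_Rintegral f g :
  L0_dist f g = \int[P]_x Num.min 1 `|f x - g x|.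
Proof. by rewrite /L0_dist unlock. Qed.

Lemma L0_dist_integral f g :
  (L0_dist f g)%:E = (\int[P]_x (Num.min 1 `|f x - g x|)%:E)%E.
Proof.
rewrite L0_dist_Rintegral /Rintegral fineK//.
exact: integrable_fin_num (integrable_min1 f g).
Qed.

(** Once a block of the truncated series sums to less than 1, each of its terms is below 1, so the
    truncation is inactive there and the increments themselves satisfy the Cauchy criterion. *)
Lemma cvg_sum_min1 (u : R^nat) :
  (\sum_(n <oo) (Num.min 1 `|u n.+1 - u n|)%:E < +oo)%E -> cvgn u.
Proof.
set a := fun n => Num.min 1 `|u n.+1 - u n|.
have a0 n : 0 <= a n by case/andP: (min1_01 (u n.+1) (u n)).
move=> aoo.
have soo : (\sum_(n <oo) (a n)%:E)%E \is a fin_num.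
  by rewrite ge0_fin_numE//; apply: nneseries_ge0 => n _ _; rewrite lee_fin.
have : cvgn (series a).
  apply: nondecreasing_is_cvgn; first exact: nondecreasing_series.
  exists (fine (\sum_(n <oo) (a n)%:E)%E) => _ [n _ <-].
  rewrite -lee_fin fineK// /series/= -sumEFin.
  by apply: nneseries_lim_ge => k _ _; rewrite lee_fin.
move=> /cauchy_cvgP/cauchy_seriesP a_small.
suff su : cvgn (series (telescope u)).
  have -> : u = (fun n => u 0%N + series (telescope u) n).
    by apply/funext => n; exact: eq_sum_telescope.
  by apply: is_cvgD => //; exact: is_cvg_cst.
apply/cauchy_cvgP/cauchy_seriesP => e e0.
have e10 : 0 < Num.min 1 e by rewrite lt_min ltr01 e0.
apply: filterS (a_small _ e10) => -[m n] /=.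
rewrite ger0_norm ?sumr_ge0// lt_min => /andP[s1 se].
apply: le_lt_trans se; apply: le_trans (ler_norm_sum _ _ _) _.
apply: ler_sum_nat => k kmn.
have : a k < 1.
  apply: le_lt_trans s1; rewrite (bigD1_seq k)//= ?iota_uniq//.
    by rewrite lerDl sumr_ge0.
  by rewrite mem_index_iota.
by rewrite /a gt_min ltxx /= => /ltW/min_r ->.
Qed.

(** The distances are summable, so the series of truncated increments has finite integral and is
    finite almost everywhere. Hence the sequence converges almost everywhere, and dominated
    convergence turns this into convergence of the distances. *)
Lemma L0_fast_cauchy_cvg (u : nat -> L0 P) :
  (forall n, L0_dist (u n) (u n.+1) <= 1 / (2 ^ n.+1)%:R) ->
  exists g, L0_dist (u n) g @[n --> \oo] --> 0.
Proof.
move=> ufast.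
have sum_fin : (\int[P]_x \sum_(n <oo) (Num.min 1 `|u n.+1 x - u n x|)%:E
    <= 1%:E)%E.
  have m01 n x : (0 <= (Num.min 1 `|u n.+1 x - u n x|)%:E)%E.
    by rewrite lee_fin; case/andP: (min1_01 (u n.+1 x) (u n x)).
  have mm n : measurable_fun setT (fun x => (Num.min 1 `|u n.+1 x - u n x|)%:E).
    by apply/measurable_EFinP; exact: measurable_min1.
  rewrite integral_nneseries//.
  apply: le_trans (epsilon_trick0 xpredT ler01).
  apply: lee_nneseries => [n _ _|n _]; first exact: integral_ge0.
  rewrite -L0_dist_integral lee_fin; apply: le_trans (ufast n).
  rewrite !L0_dist_Rintegral le_eqVlt; apply/predU1P; left.
  by apply: eq_Rintegral => x _; rewrite distrC.
have ucvg : \forall x \ae P, cvgn (fun n => u n x).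
  have : P.-integrable setT
      (fun x => \sum_(n <oo) (Num.min 1 `|u n.+1 x - u n x|)%:E)%E.
    have s0 x : (0 <= \sum_(n <oo) (Num.min 1 `|u n.+1 x - u n x|)%:E)%E.
      apply: nneseries_ge0 => n _ _; rewrite lee_fin.
      by case/andP: (min1_01 (u n.+1 x) (u n x)).
    apply/integrableP; split.
      apply: ge0_emeasurable_sum => n; last first.
        by move=> _; apply/measurable_EFinP; exact: measurable_min1.
      by move=> x _ _; rewrite lee_fin; case/andP: (min1_01 (u n.+1 x) (u n x)).
    under eq_integral do rewrite gee0_abs//.
    by apply: le_lt_trans sum_fin _; rewrite ltry.
  move=> /(integrable_ae measurableT); apply: filterS => x /(_ I).
  move=> sx; apply: cvg_sum_min1; move: sx; rewrite fin_numE => /andP[_ sx].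
  by rewrite ltey.
(* The upper limit is measurable on the whole space and equals the limit wherever the sequence
   converges. *)
pose g0 x := fine (limn_esup (fun n => (u n x)%:E)).
have mg0 : measurable_fun setT g0.
  apply: measurableT_comp => //; apply: measurable_fun_limn_esup => n.
  exact/measurable_EFinP.
have ug0 : \forall x \ae P, u n x @[n --> \oo] --> g0 x.
  apply: filterS ucvg => x ux; rewrite /g0 is_cvg_limn_esupE; last first.
    apply/cvg_ex; exists (limn (fun n => u n x))%:E.
    by apply/cvg_EFin => //; exact: nearW.
  by rewrite (EFin_lim ux).
pose g : L0 P := L0_class P (mfun_Sub (mem_set mg0)).
have gE : g = g0 %[ae P] by exact: L0_classK.
exists g.
have [|||||_ _ +] := @dominated_convergence _ T R P setT measurableT
  (fun n x => (Num.min 1 `|u n x - g x|)%:E) (cst 0%E) (cst 1%E).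
- by move=> n; apply/measurable_EFinP; exact: measurable_min1.
- exact: measurable_cst.
- apply: filterS2 ug0 gE => x ux /(_ I) gx _.
  apply: cvg_EFin; first exact: nearW.
  apply: (@squeeze_cvgr _ _ _ _ (cst 0) (fun n => `|u n x - g x|)).
  + by apply: nearW => n /=; rewrite le_min ler01 normr_ge0 ge_min lexx orbT.
  + exact: cvg_cst.
  + rewrite gx -(normr0 R) -(subrr (g0 x)); apply: cvg_norm.
    by apply: cvgB => //; exact: cvg_cst.
- exact: finite_measure_integrable_cst.
- apply: aeW => x n _; have /andP[m0 m1] := min1_01 (u n x) (g x).
  by rewrite gee0_abs ?lee_fin.
rewrite integral0 => /fine_cvgP[_]; apply: cvg_trans.
by apply: near_eq_cvg; apply: nearW => n /=; rewrite L0_dist_Rintegral.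
Qed.

End L0_complete.

(** * Completeness of L0 and convex compactness of sets bounded in probability *)

Section L0_convex_compactness.
Context (d : measure_display) (T : measurableType d) (R : realType).
Variable P : probability T R.
Implicit Types f g h : L0 P.

Lemma L0_complete (F : set_system (L0 P)) :
  ProperFilter F -> cauchy F -> exists g : L0 P, F --> g.
Proof.
move=> PF /cauchyP cF.
(* The extra factor 1/2 is there because consecutive centres are only within r n + r (n + 1), which
   is 3/4 of 1 / 2 ^ (n + 1). *)
pose r n : R := 2^-1 / (2 ^ n.+1)%:R.
have r0 n : 0 < r n by rewrite divr_gt0 ?invr_gt0// ltr0n expn_gt0.
have [u uF] := choice (fun n => cF (r n) (r0 n)).
have [n|g ug] := @L0_fast_cauchy_cvg _ _ _ P u.
  have [f [un un1]] := filter_ex (filterI (uF n) (uF n.+1)).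
  have : ball (u n) (r n + r n.+1) (u n.+1).
    by apply: ball_triangle un _; exact: ball_sym.
  rewrite ballEmdist /= => /ltW/le_trans; apply.
  rewrite /r [(2 ^ n.+2)%N]expnS natrM invfM; set s := (2 ^ n.+1)%:R^-1.
  have : 0 <= s by rewrite invr_ge0 ler0n.
  lra.
exists g => U /nbhs_ballP[e /= e0 eU].
have e20 : 0 < e / 2 by rewrite divr_gt0.
have r_cvg : r n @[n --> \oo] --> 0.
  rewrite -(mulr0 2^-1) /r; apply: cvgM; first exact: cvg_cst.
  rewrite [X in X @ \oo --> _](_ : _ = fun n => (2^-1 : R) ^+ n.+1);
    last first.
    by apply/funext => n; rewrite natrX exprVn.
  rewrite (cvg_shiftS (fun n => (2^-1 : R) ^+ n)); apply: cvg_expr.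
  by rewrite ger0_norm ?invr_ge0// invf_lt1// ltr1n.
have [n [rn un]] : exists n, r n < e / 2 /\ L0_dist (u n) g < e / 2.
  near \oo => n; exists n; split; near: n.
    by apply: (cvgr_lt _ r_cvg).
  by apply: (cvgr_lt _ ug).
apply: filterS (uF n) => f uf; apply: eU.
apply: (@ball_split _ _ (u n)).
  by apply: ball_sym; rewrite ballEmdist.
by apply: le_ball uf; exact: ltW.
Unshelve. all: by end_near. Qed.

Lemma inv1D_01 (x : R) : 0 <= (1 + `|x|)^-1 <= 1.
Proof.
have x0 := normr_ge0 x.
by rewrite invr_ge0 addr_ge0//= invf_le1 ?lerDl// ltr_wpDr.
Qed.

Lemma integrable_inv1D (u : T -> R) : measurable_fun setT u ->
  P.-integrable setT (EFin \o fun x => (1 + `|u x|)^-1).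
Proof.
move=> mu; apply: integrable_01 => [|x]; last exact: inv1D_01.
apply: (@measurableT_comp _ _ _ _ _ _ (fun t : R => (1 + `|t|)^-1)) => //.
apply: continuous_measurable_fun => t; apply: cvgV.
  by rewrite gt_eqF// ltr_wpDr.
by apply: cvgD; [exact: cvg_cst|exact: norm_continuous].
Qed.

(** This is the functional J; the absolute value keeps the integrand between 0 and 1 on all of L0
    and changes nothing on [L0_plus]. *)
Definition inv1D_mean f : R := \int[P]_x (1 + `|f x|)^-1.

Lemma inv1D_mean_ge0 f : 0 <= inv1D_mean f.
Proof. by apply: Rintegral_ge0 => x _; case/andP: (inv1D_01 (f x)). Qed.

Lemma inv1D_mean_le1 f : inv1D_mean f <= 1.
Proof.
have P1 : fine (P setT) = 1 by rewrite probability_setT.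
rewrite (_ : 1 = \int[P]_x cst 1 x); last by rewrite Rintegral_cst// P1 mulr1.
apply: le_Rintegral => // [||x _]; last by case/andP: (inv1D_01 (f x)).
  exact: integrable_inv1D.
exact: finite_measure_integrable_cst.
Qed.

(* The bound rests on 1/A + 1/B - 4/(A+B) = (A-B)^2 / (A B (A+B)) with
   A = 1 + a and B = 1 + b. *)
Lemma min1_le_convexity_gap (M c a b : R) :
  0 < M -> 0 < c -> 0 <= a -> 0 <= b ->
  Num.min 1 `|a - b| + 2 * (1 + M) ^+ 3 / c * 2 * (1 + (a + b) / 2)^-1 <=
  c + (M <= a)%R%:R + (M <= b)%R%:R +
  2 * (1 + M) ^+ 3 / c * ((1 + a)^-1 + (1 + b)^-1).
Proof.
move=> M0 c0 a0 b0.
set K := 2 * (1 + M) ^+ 3 / c.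
have K0 : 0 <= K.
  by rewrite /K divr_ge0 ?mulr_ge0 ?exprn_ge0 ?addr_ge0// ltW.
have gapE : (1 + a)^-1 + (1 + b)^-1 - 2 * (1 + (a + b) / 2)^-1 =
    (a - b) ^+ 2 / ((1 + a) * (1 + b) * (2 + a + b)).
  field.
  by rewrite !gt_eqF//; lra.
have den0 : 0 < (1 + a) * (1 + b) * (2 + a + b).
  by rewrite !mulr_gt0//; lra.
set gap := (a - b) ^+ 2 / _ in gapE.
have gap0 : 0 <= gap by rewrite divr_ge0 ?sqr_ge0// ltW.
suff : Num.min 1 `|a - b| <= c + (M <= a)%R%:R + (M <= b)%R%:R + K * gap.
  by rewrite -gapE; lra.
have Kgap0 : 0 <= K * gap by rewrite mulr_ge0.
have m1 : Num.min 1 `|a - b| <= 1 by rewrite ge_min lexx.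
(* If a or b reaches [M], its indicator alone pays for the truncated distance. Otherwise the
   denominator of [gap] is at most 2 (1 + M)^3, so [K * gap] dominates t^2 / c, and t <= c + t^2 /
   c. *)
have [Ma|aM] := leP M a; first by have := ler0n R (M <= b)%R; rewrite /=; lra.
have [Mb|bM] := leP M b; first by rewrite /=; lra.
rewrite /= !addr0 (le_trans (_ : _ <= `|a - b|))//.
  by rewrite ge_min lexx orbT.
set t := `|a - b|.
have tE : (a - b) ^+ 2 = t ^+ 2 by rewrite /t real_normK// num_real.
have : t ^+ 2 / c <= K * gap.
  rewrite (_ : K * gap = t ^+ 2 / c *
      (2 * (1 + M) ^+ 3 / ((1 + a) * (1 + b) * (2 + a + b)))); last first.
    by rewrite /K /gap tE; ring.
  rewrite ler_peMr ?divr_ge0 ?sqr_ge0 ?(ltW c0)// ler_pdivlMr// mul1r.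
  rewrite (_ : 2 * _ = (1 + M) * (1 + M) * (2 * (1 + M))); last by ring.
  by rewrite !ler_pM ?mulr_ge0//; lra.
have : t <= c + t ^+ 2 / c.
  rewrite -(ler_pM2r c0) mulrDl divfK ?gt_eqF//; nra.
lra.
Qed.

Lemma integrable_RD (u v : T -> R) :
  P.-integrable setT (EFin \o u) -> P.-integrable setT (EFin \o v) ->
  P.-integrable setT (EFin \o fun x => u x + v x).
Proof. by move=> iu iv; exact: (integrableD measurableT iu iv). Qed.

Lemma integrable_RZl (k : R) (u : T -> R) :
  P.-integrable setT (EFin \o u) ->
  P.-integrable setT (EFin \o fun x => k * u x).
Proof. by move=> iu; exact: (integrableZl measurableT k iu). Qed.

Lemma ae_eq_Rintegral (u v : T -> R) :
  measurable_fun setT u -> measurable_fun setT v ->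
  (\forall x \ae P, u x = v x) -> \int[P]_x u x = \int[P]_x v x.
Proof.
move=> mu mv uv; rewrite /Rintegral; congr fine; apply: ae_eq_integral => //.
- exact/measurable_EFinP.
- exact/measurable_EFinP.
- by apply: filterS uv => x ->.
Qed.

Lemma measurable_tail (M : R) f : measurable [set x | M <= `|f x|].
Proof.
rewrite -[X in measurable X]setTI; apply: measurable_fun_le => //.
exact: measurableT_comp.
Qed.

Lemma bounded_in_probability_tail (B : set (L0 P)) (e : R) :
  bounded_in_probability B -> 0 < e ->
  exists2 M : R, 0 < M & forall f, B f -> fine (P [set x | M <= `|f x|]) <= e.
Proof.
move=> bB e0.
have tail : \forall M \near pinfty_nbhs R,
    (ereal_sup [set P [set x | (M <= `|f x|)%R] | f in B] < e%:E)%E.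
  apply: (bB [set y | y < e%:E]%E); apply: open_nbhs_nbhs; split.
    exact: open_ereal_lt_ereal.
  by rewrite /= lte_fin.
have [M [M0 Me]] : exists M : R, 0 < M /\
    (ereal_sup [set P [set x | (M <= `|f x|)%R] | f in B] < e%:E)%E.
  near (pinfty_nbhs R) => M; exists M; split; near: M => //.
  exact: nbhs_pinfty_gt.
exists M => // f Bf; rewrite -lee_fin fineK; last first.
  exact/fin_num_measure/measurable_tail.
apply: le_trans (ltW Me); by apply: ereal_sup_ubound; exists f.
Unshelve. all: by end_near. Qed.

(** Integrating the pointwise gap bound gives four terms of size at most e / 4: the constant c, the
    two tails beyond [M], and [K] times the convexity gap, which is why eta is c / K. *)
Lemma inv1D_mean_uniformly_convex (B : set (L0 P)) (e : R) :
  B `<=` L0_plus P -> bounded_in_probability B -> 0 < e ->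
  exists2 eta : R, 0 < eta & forall f g h, B f -> B g ->
    (\forall x \ae P, h x = (f x + g x) / 2) ->
    inv1D_mean f + inv1D_mean g - 2 * inv1D_mean h <= eta -> L0_dist f g <= e.
Proof.
move=> Bpos Bbd e0.
have c0 : 0 < e / 4 by rewrite divr_gt0.
have [M M0 tail] := bounded_in_probability_tail Bbd c0.
set c := e / 4 in c0 tail.
pose K := 2 * (1 + M) ^+ 3 / c.
have K0 : 0 < K.
  by rewrite divr_gt0// mulr_gt0// exprn_gt0// addr_gt0.
exists (c / K) => [|f g h Bf Bg hE gap]; first by rewrite divr_gt0.
(* Absolute values let the pointwise bound hold at every x; non-negativity, known almost everywhere,
   identifies the integrals in [hW] and [dE]. *)
pose W x := (1 + (`|f x| + `|g x|) / 2)^-1.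
have absE x : (`|f x| + `|g x|) / 2 = `|(`|f x| + `|g x|) / 2|.
  by rewrite [RHS]ger0_norm// divr_ge0// addr_ge0.
have mabs (k : L0 P) : measurable_fun setT (fun x => `|k x|).
  exact: measurableT_comp.
have iW : P.-integrable setT (EFin \o W).
  rewrite /W; under [X in EFin \o X]eq_fun do rewrite absE.
  apply: integrable_inv1D; apply: measurable_funM => //.
  exact: measurable_funD.
have mEFin (u : T -> R) :
    P.-integrable setT (EFin \o u) -> measurable_fun setT u.
  by move=> /measurable_int/measurable_EFinP.
have iJ (k : L0 P) : P.-integrable setT (EFin \o fun x => (1 + `|k x|)^-1).
  by apply: integrable_inv1D.
pose D x := Num.min 1 `| `|f x| - `|g x| |.
have iD : P.-integrable setT (EFin \o D).
  apply: integrable_01 => [|x]; last exact: min1_01.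
  apply: measurable_minr => //; apply: measurableT_comp => //.
  exact: measurable_funB.
have hW : inv1D_mean h = \int[P]_x W x.
  apply: ae_eq_Rintegral; [exact/mEFin|exact/mEFin|].
  apply: filterS3 (Bpos f Bf) (Bpos g Bg) hE => x f0 g0 ->.
  by rewrite /W !ger0_norm// ?divr_ge0// addr_ge0.
have dE : L0_dist f g = \int[P]_x D x.
  rewrite L0_dist_Rintegral; apply: ae_eq_Rintegral.
  - exact: measurable_min1.
  - exact/mEFin.
  by apply: filterS2 (Bpos f Bf) (Bpos g Bg) => x f0 g0;
    rewrite /D (ger0_norm f0) (ger0_norm g0).
pose tl (k : L0 P) x : R := \1_[set x | M <= `|k x|] x.
have itl (k : L0 P) : P.-integrable setT (EFin \o tl k).
  exact/integrable_indic/measurable_tail.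
have tlE (k : L0 P) : B k -> \int[P]_x tl k x <= c.
  move=> Bk; apply: le_trans (tail k Bk).
  by rewrite /Rintegral integral_indic ?setIT//; exact: measurable_tail.
have ic : P.-integrable setT (EFin \o cst c).
  exact: finite_measure_integrable_cst.
have : \int[P]_x (D x + K * 2 * W x) <=
       \int[P]_x (c + (tl f x + (tl g x +
          K * ((1 + `|f x|)^-1 + (1 + `|g x|)^-1)))).
  apply: le_Rintegral => //.
  - by apply: integrable_RD => //; exact: integrable_RZl.
  - do 3 (apply: integrable_RD => //).
    by apply: integrable_RZl; exact: integrable_RD.
  move=> x _.
  have := min1_le_convexity_gap M0 c0 (normr_ge0 (f x)) (normr_ge0 (g x)).
  rewrite -/K -/(W x) -/(D x) /tl !indicE !mem_setE.
  by rewrite -!addrA.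
rewrite RintegralD//; last exact: integrable_RZl.
rewrite RintegralZl//.
rewrite RintegralD//; last first.
  do 2 (apply: integrable_RD => //).
  by apply: integrable_RZl; exact: integrable_RD.
rewrite RintegralD//; last first.
  by apply: integrable_RD => //; apply: integrable_RZl; exact: integrable_RD.
rewrite RintegralD//; last by apply: integrable_RZl; exact: integrable_RD.
rewrite RintegralZl//; last exact: integrable_RD.
rewrite RintegralD// Rintegral_cst// -hW -dE.
have P1 : fine (P setT) = 1 by rewrite probability_setT.
rewrite -/(inv1D_mean f) -/(inv1D_mean g) P1 mulr1.
have := tlE f Bf; have := tlE g Bg.
move: gap; rewrite ler_pdivlMr// /c.
lra.
Qed.

Lemma bounded_convexly_compact (C : set (L0 P)) :
  C `<=` L0_plus P -> convex_set C -> bounded_in_probability C ->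
  convexly_compact C.
Proof.
move=> Cpos cC Cbd; split=> // J A F [i0 Ai0] AF finAF.
have Fclosed i : A i -> closed (F i) by case/AF.
have Fconvex i : A i -> convex_set (F i) by case/AF.
have FC i : A i -> F i `<=` C by case/AF.
pose FE (K : {fset J}) := C `&` \bigcap_(i in [set i | i \in K]) F i.
have FE_neq0 K : {subset K <= A} -> FE K !=set0.
  (* Adding the fixed index [i0] forces the common point into [C], also for empty [K]. *)
  move=> KA; have [|f fF] := finAF (i0 |` K)%fset.
    by move=> i /fset1UP[->|/KA//]; exact/mem_set.
  exists f; split; first by apply: (FC i0) => //; apply: fF; exact: fset1U1.
  by move=> i iK; apply: fF; exact: fset1Ur.
have FE_convex K : {subset K <= A} -> convex_set (FE K).
  move=> KA f g t /set_mem[Cf Ff] /set_mem[Cg Fg]; apply/mem_set; split.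
    by apply/set_mem/cC; exact/mem_set.
  move=> i /[dup] iK /KA/set_mem Ai.
  apply/set_mem/(Fconvex i Ai); apply/mem_set.
    exact: Ff.
  exact: Fg.
have FE_lb K : has_lbound (inv1D_mean @` FE K).
  by exists 0 => _ [f _ <-]; exact: inv1D_mean_ge0.
pose v K := inf (inv1D_mean @` FE K).
pose S := v @` [set K : {fset J} | {subset K <= A}].
have S_sup : has_sup S.
  split; first by exists (v fset0), fset0.
  exists 1 => _ [K KA <-]; have [f fK] := FE_neq0 K KA.
  apply: le_trans (inv1D_mean_le1 f).
  by apply: ge_inf; [exact: FE_lb|exists f].
pose D := [set p : {fset J} * R | {subset p.1 <= A} /\ 0 < p.2].
pose B (p : {fset J} * R) := FE p.1 `&` [set f | inv1D_mean f <= sup S + p.2].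
pose G := filter_from D B.
have PG : ProperFilter G.
  apply: filter_from_proper; last first.
    (* Since v K <= sup S, any point of [FE K] within r of the infimum belongs to [B (K, r)]. *)
    move=> [K r] [/= KA r0].
    have [|_ [f fK <-] fr] := @inf_adherent _ (inv1D_mean @` FE K) r r0.
      by split => //; have [f fK] := FE_neq0 K KA; exists (inv1D_mean f), f.
    exists f; split => //=; apply: (le_trans (ltW fr)); rewrite lerD2r.
    by apply: sup_upper_bound => //; exists K.
  apply: filter_from_filter; first by exists (fset0, 1).
  move=> [K r] [L s] [/= KA r0] [/= LA s0].
  exists ((K `|` L)%fset, Num.min r s).
    split => /=; last by rewrite lt_min r0.
    by move=> i /fsetUP[/KA|/LA].
  move=> f [[/= Cf fF] frs]; rewrite /B /FE /=.
  split; split.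
  - by split => // i iK; apply: fF => /=; rewrite inE iK.
  - by apply: le_trans frs _; rewrite lerD2l ge_min lexx.
  - by split => // i iL; apply: fF => /=; rewrite inE iL orbT.
  - by apply: le_trans frs _; rewrite lerD2l ge_min lexx orbT.
have cG : cauchy G.
  apply: cauchy_exP => e e0.
  have e20 : 0 < e / 2 by rewrite divr_gt0.
  have [eta eta0 close] := inv1D_mean_uniformly_convex Cpos Cbd e20.
  have eta40 : 0 < eta / 4 by rewrite divr_gt0.
  (* Two members of [B (K, eta / 4)] have J at most sup S + eta / 4, while their midpoint stays in
     [FE K] and has J above sup S - eta / 4; the convexity gap is therefore at most eta. *)
  have [_ [K KA <-] vK] := sup_adherent eta40 S_sup.
  have DK : D (K, eta / 4) by [].
  have [f [fK fS]] : B (K, eta / 4) !=set0.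
    by apply: (@filter_ex _ G); exists (K, eta / 4).
  exists f; exists (K, eta / 4) => // g [gK gS].
  rewrite ballEmdist /=; apply: (@le_lt_trans _ _ (e / 2)); last first.
    by rewrite ltr_pdivrMr// mulr_natr mulr2n ltrDl.
  have h0 : 0 <= 2^-1 :> R by rewrite invr_ge0.
  have h1 : 2^-1 <= 1 :> R by rewrite invf_le1// ler1n.
  pose h : L0 P := conv (Itv01 h0 h1) (f : convex_lmodType (L0 P)) g.
  apply: (close f g h); [by case: fK|by case: gK| |].
    have hE : h = 2^-1 *: f + (1 - 2^-1) *: g by [].
    rewrite hE; apply: filterS3 (L0_DE (2^-1 *: f) ((1 - 2^-1) *: g))
      (L0_ZE 2^-1 f) (L0_ZE (1 - 2^-1) g).
    by move=> x /(_ I) -> /(_ I) /= -> /(_ I) ->; lra.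
  have : v K <= inv1D_mean h.
    apply: ge_inf; first exact: FE_lb.
    by exists h => //; apply/set_mem/(FE_convex K KA); apply/mem_set.
  move: fS gS vK => /=; lra.
have [g Gg] := L0_complete PG cG.
(* [F i] contains the filter set [B ([fset i], 1)], so it meets every neighbourhood of the limit. *)
exists g => i Ai; apply: (Fclosed i Ai) => U gU.
apply: (@filter_ex _ G); apply: filterI; last exact: Gg.
exists ([fset i]%fset, 1).
  by split => //= j; rewrite inE => /eqP ->; exact/mem_set.
by move=> f [[_ fF] _]; apply: fF; rewrite /= inE.
Qed.

End L0_convex_compactness.

(** * From the two one-sided bounds to a saddle point *)

Lemma lee_EFin_lt (R : realType) (x : R) (y : \bar R) :
  (forall a : R, (a%:E < y)%E -> a <= x) -> (y <= x%:E)%E.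
Proof.
rewrite leNgt => yx; apply/negP; case: y yx => [y||//] yx.
  by rewrite lte_fin => xy; have := yx ((x + y) / 2); rewrite lte_fin; lra.
by move=> _; have := yx (x + 1); rewrite ltry => /(_ isT); lra.
Qed.

Theorem theorem4p9 (d : measure_display) (T : measurableType d) (R : realType)
  (P : probability T R) (Pcomplete : measure_is_complete P)
  (C D : set (L0 P))
  (C0 : C !=set0) (CL0 : C `<=` L0_plus P)
  (Cclosed : closed C) (Cconvex : convex_set C)
  (Ccompact : convexly_compact C \/ bounded_in_probability C)
  (D0 : D !=set0) (DL0 : D `<=` L0_plus P)
  (Dclosed : closed D) (Dconvex : convex_set D)
  (Dcompact : convexly_compact D \/ bounded_in_probability D)
  (Phi : L0 P -> L0 P -> R)
  (Phi_concave : forall g, D g -> concave_function C (fun f => Phi f g))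
  (Phi_usc : forall g, D g ->
     upper_semicontinuous (fun f : subspace C => (Phi f g)%:E))
  (Phi_convex : forall f, C f -> convex_function D (fun g => Phi f g))
  (Phi_lsc : forall f, C f ->
     lower_semicontinuous (fun g : subspace D => (Phi f g)%:E)) :
  (exists f0 g0, [/\ C f0, D g0 &
     forall f g, C f -> D g ->
       Phi f g0 <= Phi f0 g0 /\ Phi f0 g0 <= Phi f0 g]) /\
  ereal_sup [set ereal_inf [set (Phi f g)%:E | g in D] | f in C] =
  ereal_inf [set ereal_sup [set (Phi f g)%:E | f in C] | g in D].
Proof.
have kC : convexly_compact C.
  by case: Ccompact => // ?; exact: bounded_convexly_compact.
have kD : convexly_compact D.
  by case: Dcompact => // ?; exact: bounded_convexly_compact.
set lo := ereal_sup _; set hi := ereal_inf _.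
have [a g ahi Dg|f0 Cf0 f0hi] := convexly_compact_minimax
    (A := [set a : R | (a%:E < hi)%E]) kC Cclosed C0 Dconvex Phi_concave
    Phi_usc Phi_convex.
  have : (a%:E < ereal_sup [set (Phi f g)%:E | f in C])%E.
    by apply: (lt_le_trans ahi); apply: ereal_inf_lbound; exists g.
  by move=> /ereal_sup_gt[_ [f Cf <-]]; rewrite lte_fin; exists f.
(* The roles of [C] and [D] are exchanged; a level [a] for -Phi encodes the upper bound -a for Phi,
   with -a strictly above [lo]. *)
have [f Cf|f Cf|g Dg|a f alo Cf|g0 Dg0 g0lo] := @convexly_compact_minimax R
    (L0 P) (L0 P) D C (fun g f => - Phi f g)
    [set a : R | (lo < (- a)%:E)%E] kD Dclosed D0 Cconvex.
- by move=> t x y Dx Dy; rewrite /= !opprK; exact: Phi_convex.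
- rewrite /upper_semicontinuous; under eq_fun do rewrite EFinN oppeK.
  exact: Phi_lsc.
- exact: Phi_concave.
- have : (ereal_inf [set (Phi f g)%:E | g in D] < (- a)%:E)%E.
    by apply: le_lt_trans alo; apply: ereal_sup_ubound; exists f.
  by move=> /ereal_inf_lt[_ [g Dg <-]]; rewrite lte_fin ltrNr; exists g.
have hi_le g : D g -> (hi <= (Phi f0 g)%:E)%E.
  by move=> Dg; apply: lee_EFin_lt => a ahi; exact: f0hi.
have le_lo f : C f -> ((Phi f g0)%:E <= lo)%E.
  move=> Cf; rewrite -leeN2 -EFinN; apply: lee_EFin_lt => a alo.
  by apply: g0lo => //=; rewrite EFinN lteNr.
have lo_hi : (lo <= hi)%E.
  apply: ge_ereal_sup => _ [f Cf <-]; apply: le_ereal_inf_tmp => _ [g Dg <-].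
  apply: (@le_trans _ _ (Phi f g)%:E).
    by apply: ereal_inf_lbound; exists g.
  by apply: ereal_sup_ubound; exists f.
(* At (f0, g0) the two bounds give [hi] <= Phi(f0, g0) <= [lo], which closes the chain with weak
   duality. *)
split; last first.
  apply/eqP; rewrite eq_le lo_hi /=.
  exact: le_trans (hi_le g0 Dg0) (le_lo f0 Cf0).
exists f0, g0; split => // f g Cf Dg; rewrite -!lee_fin; split.
  exact: le_trans (le_lo f Cf) (le_trans lo_hi (hi_le g0 Dg0)).
exact: le_trans (le_lo f0 Cf0) (le_trans lo_hi (hi_le g Dg)).
Qed.
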